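(* Let $T\in\mathbb{N}$, and let $[0,T+2]$ and $[1,T+1]$ denote the discrete intervals of integers. Let $h\colon[1,T+1]\times\mathbb{R}^2\to\mathbb{R}$ be such that $h(t,\cdot,\cdot)$ is continuous on $\mathbb{R}^2$ for each $t\in[1,T+1]$ and $h$ is non-increasing in its third variable, and let $g\colon[0,T+2]\to\mathbb{R}^+$ be continuous. Consider the boundary value problem $$u^{\Delta\Delta}(t-1)+h(t,u(t),u^{\Delta}(t-1))=0\ \text{ for } t\in[1,T+1],\qquad u^{\Delta}(0)=0,\qquad u(T+2)=g(T+2).\tag{P}$$ Let $\alpha,\beta\colon[0,T+2]\to\mathbb{R}$ be a lower solution and an upper solution of (P), respectively, with $\alpha(t)\le\beta(t)$ for all $t\in[1,T+1]$. Then (P) has a solution $u\colon[0,T+2]\to\mathbb{R}$ satisfying $$\alpha(t)\le u(t)\le\beta(t)\quad\text{for all } t\in[0,T+2].$$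
   Context: All intervals are discrete: $[0,T+2]=\{0,1,\dots,T+2\}$ and $[1,T+1]=\{1,2,\dots,T+1\}$. $\mathbb{R}^+=(0,\infty)$. (Continuity of $g$ on the discrete set $[0,T+2]$ is automatic.) For $u\colon[0,T+2]\to\mathbb{R}$, the delta derivative is the forward difference $u^{\Delta}(i)=u(i+1)-u(i)$ for $i\in[0,T+1]$, and $u^{\Delta\Delta}=(u^{\Delta})^{\Delta}$, so that $u^{\Delta\Delta}(t-1)=u(t+1)-2u(t)+u(t-1)$ for $t\in[1,T+1]$. A solution of (P) is a function $u\colon[0,T+2]\to\mathbb{R}$ satisfying the difference equation for all $t\in[1,T+1]$ and both boundary conditions. A function $\alpha\colon[0,T+2]\to\mathbb{R}$ is a lower solution of (P) if $\alpha^{\Delta\Delta}(t-1)+h(t,\alpha(t),\alpha^{\Delta}(t-1))\ge 0$ for all $t\in[1,T+1]$, $\alpha^{\Delta}(0)\ge 0$, and $\alpha(T+2)\le g(T+2)$. A function $\beta\colon[0,T+2]\to\mathbb{R}$ is an upper solution of (P) if $\beta^{\Delta\Delta}(t-1)+h(t,\beta(t),\beta^{\Delta}(t-1))\le 0$ for all $t\in[1,T+1]$, $\beta^{\Delta}(0)\le 0$, and $\beta(T+2)\ge g(T+2)$. *)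

(* Defs.v *)
From mathcomp Require Import all_boot all_order all_algebra.
From mathcomp Require Import all_classical all_reals all_analysis.

Set Implicit Arguments.
Unset Strict Implicit.
Unset Printing Implicit Defensive.

Import Order.TTheory GRing.Theory Num.Theory numFieldNormedType.Exports.

Local Open Scope ring_scope.

(* A function on a discrete interval [a, b] is represented by a function on
   nat; every condition below only involves its values on [a, b]: [0, T+2] for
   u, alpha, beta, g and [1, T+1] for the first argument of h. *)

Definition delta (R : realType) (u : nat -> R) : nat -> R :=
  fun i => u i.+1 - u i.

Definition bvp_operator (R : realType) (h : nat -> R -> R -> R)
    (u : nat -> R) (t : nat) : R :=
  delta (delta u) t.-1 + h t (u t) (delta u t.-1).

Definition is_solution (R : realType) (T : nat) (h : nat -> R -> R -> R)
    (g u : nat -> R) : Prop :=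
  [/\ forall t, (1 <= t <= T.+1)%N -> bvp_operator h u t = 0,
      delta u 0%N = 0
    & u T.+2 = g T.+2].

Definition lower_solution (R : realType) (T : nat) (h : nat -> R -> R -> R)
    (g alpha : nat -> R) : Prop :=
  [/\ forall t, (1 <= t <= T.+1)%N -> 0 <= bvp_operator h alpha t,
      0 <= delta alpha 0%N
    & alpha T.+2 <= g T.+2].

Definition upper_solution (R : realType) (T : nat) (h : nat -> R -> R -> R)
    (g beta : nat -> R) : Prop :=
  [/\ forall t, (1 <= t <= T.+1)%N -> bvp_operator h beta t <= 0,
      delta beta 0%N <= 0
    & g T.+2 <= beta T.+2].

(* Main.v *)
(** Regard the equation at each [t] in [1, T+1] and the two boundary conditions
    as equations [F i u = 0], one for each [i] in [0, T+2].  As [h] is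
    non-increasing in its third variable, [F i] is non-decreasing in every
    [u j] with [j <> i], so Perron's method applies and no fixed point theorem
    is needed: the pointwise supremum of the subsolutions lying between [alpha]
    and [beta] is again a subsolution, and if one of its equations were strict,
    its value at that point could be increased. *)

Require Import Defs.
From mathcomp Require Import all_boot all_order all_algebra.
From mathcomp Require Import all_classical all_reals all_analysis.
From mathcomp Require Import lra.

Import Order.TTheory GRing.Theory Num.Theory numFieldNormedType.Exports.

Local Open Scope ring_scope.

(** [D] marks the relevant indices, since functions on a discrete interval are encoded on all of
    [nat]; bounds and equations are only considered there. *)
Lemma perron_quasimonotone (R : realType) (I : eqType) (D : pred I)
    (F : I -> (I -> R) -> R) (a b : I -> R)
    (F_mono : forall i, D i -> forall u v : I -> R, u i = v i ->
       (forall j, D j -> u j <= v j) -> F i u <= F i v)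
    (F_cont : forall i, D i -> forall u : I -> R,
       continuous (fun x => F i [eta u with i |-> x]))
    (le_ab : forall i, D i -> a i <= b i)
    (Fa_ge0 : forall i, D i -> 0 <= F i a)
    (Fb_le0 : forall i, D i -> F i b <= 0) :
  exists u : I -> R, forall i, D i -> F i u = 0 /\ a i <= u i <= b i.
Proof.
pose S := [set v : I -> R | forall i, D i -> a i <= v i <= b i /\ 0 <= F i v]%classic.
pose u i := sup [set v i | v in S]%classic.
have Sa : S a by move=> i Di; rewrite lexx le_ab //; split=> //; exact: Fa_ge0.
have has_supS i : D i -> has_sup [set v i | v in S]%classic.
  move=> Di; split; first by exists (a i), a.
  by exists (b i) => _ [v Sv <-]; have [/andP[]] := Sv i Di.
have le_u v i : D i -> S v -> v i <= u i.
  by move=> Di Sv; apply: ub_le_sup; [exact: (has_supS i Di).2 | exists v].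
have u_le i : D i -> u i <= b i.
  move=> Di; apply: ge_sup; first exact: (has_supS i Di).1.
  by move=> _ [v Sv <-]; have [/andP[]] := Sv i Di.
have upd_u i : [eta u with i |-> u i] = u :> (I -> R).
  by apply/funext => j /=; case: eqP => [->|].
(* If [F i u < 0], it stays negative when the value at [i] is lowered slightly, to [v i] for some
   [v] in [S]. The lowered function agrees with [v] at [i] and dominates it elsewhere, which
   contradicts [0 <= F i v]. *)
have Fu_ge0 i : D i -> 0 <= F i u.
  move=> Di; rewrite leNgt; apply/negP => Fu_lt0.
  have : \forall x \near u i, F i [eta u with i |-> x] < 0.
    have := F_cont i Di u (u i); rewrite /continuous_at upd_u.
    by move/(cvgr_lt (F i u)); apply.
  move=> /nbhs_ballP[e /= e0 He].
  have [_ [v Sv <-] vi] := sup_adherent e0 (has_supS i Di).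
  have vu := le_u v i Di Sv.
  have /He : ball (u i) e (v i).
    by rewrite -ball_normE /= ger0_norm ?subr_ge0 // ltrBlDr addrC -ltrBlDr.
  apply/negP; rewrite -leNgt; apply: le_trans (Sv i Di).2 _.
  apply: F_mono => //= [|j Dj]; first by rewrite eqxx.
  by case: eqP => [->//|_]; exact: le_u.
exists u => i Di; split; last by rewrite u_le // le_u.
apply/eqP; rewrite eq_le Fu_ge0 // andbT leNgt; apply/negP => Fu_gt0.
(* There is room to increase [u i] unless it touches [b i], and there comparison with [b] gives
   [F i u <= F i b <= 0]. *)
have [ui_lt|bi_le] := ltP (u i) (b i); last first.
  have ui : u i = b i by apply/eqP; rewrite eq_le u_le.
  have : F i u <= F i b by apply: F_mono.
  by apply/negP; rewrite -ltNge (le_lt_trans (Fb_le0 i Di)).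
have : \forall x \near u i, 0 < F i [eta u with i |-> x].
  have := F_cont i Di u (u i); rewrite /continuous_at upd_u.
  by move/(cvgr_gt (F i u)); apply.
move=> /nbhs_ballP[e /= e0 He].
(* The minimum keeps [x] below the barrier [b i], and [e / 2] keeps it inside the ball where [F i]
   is positive. *)
pose x := Num.min (b i) (u i + e / 2).
have ux : u i < x by rewrite lt_min ui_lt /= ltrDl divr_gt0.
have xb : x <= b i by rewrite ge_min lexx.
have xe : x <= u i + e / 2 by rewrite ge_min lexx orbT.
have Fx_gt0 : 0 < F i [eta u with i |-> x].
  apply: He; rewrite -ball_normE /= distrC ger0_norm ?subr_ge0 ?(ltW ux) //.
  lra.
(* Membership in [S] would contradict that [u i] is the supremum. For [j] other than [i], raising
   the value at [i] can only increase [F j]. *)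
suff Sx : S [eta u with i |-> x].
  by have := le_u _ i Di Sx; rewrite /= eqxx leNgt ux.
move=> j Dj /=; have [->|ji] := eqVneq j i.
  by rewrite xb (le_trans (le_u a i Di Sa) (ltW ux)) (ltW Fx_gt0).
rewrite u_le // le_u //; split=> //; apply: le_trans (Fu_ge0 j Dj) _.
apply: F_mono => //= [|k Dk]; first by rewrite (negbTE ji).
by case: eqP => [->|//]; exact: ltW.
Qed.

Section Operator.
Variables (R : realType) (h : nat -> R -> R -> R).

Lemma bvp_operatorS (u : nat -> R) (t : nat) :
  bvp_operator h u t.+1 =
  u t.+2 - u t.+1 - (u t.+1 - u t) + h t.+1 (u t.+1) (u t.+1 - u t).
Proof. by []. Qed.

(** With the middle value fixed, the second difference increases with both neighbours, while the
    backward difference fed to [h] decreases as the left neighbour grows. *)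
Lemma bvp_operator_quasimonotone (t : nat) (u v : nat -> R)
    (h_noninc : forall x v w : R, v <= w -> h t.+1 x w <= h t.+1 x v) :
  u t.+1 = v t.+1 -> u t <= v t -> u t.+2 <= v t.+2 ->
  bvp_operator h u t.+1 <= bvp_operator h v t.+1.
Proof.
move=> uv uv0 uv2; rewrite !bvp_operatorS uv.
apply: lerD; first lra.
by apply: h_noninc; lra.
Qed.

(** Both neighbours stay constant, so what remains is an affine function of [x] plus [h] along the
    line [(x, x - u t)]. *)
Lemma bvp_operator_continuous (t : nat) (u : nat -> R)
    (h_cont : continuous (fun p : R * R => h t.+1 p.1 p.2)) :
  continuous (fun x => bvp_operator h [eta u with t.+1 |-> x] t.+1).
Proof.
have tS : (t == t.+1) = false by rewrite ltn_eqF.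
have tSS : (t.+2 == t.+1) = false by rewrite gtn_eqF.
under eq_fun do rewrite bvp_operatorS /= eqxx tS tSS.
move=> x; apply: cvgD.
  by apply: cvgB; apply: cvgB; (exact: cvg_cst || exact: cvg_id).
apply: (continuous_comp (f := fun y : R => (y, y - u t))
  (g := fun p : R * R => h t.+1 p.1 p.2)); last exact: h_cont.
apply: (@cvg_pair _ _ _ (nbhs x) (nbhs x) (nbhs (x - u t)) _ _ _
  id (fun y : R => y - u t)); first exact: cvg_id.
by apply: cvgB; [exact: cvg_id | exact: cvg_cst].
Qed.

End Operator.

Theorem theorem3p5 (R : realType) (T : nat)
    (h : nat -> R -> R -> R) (g alpha beta : nat -> R)
    (h_cont : forall t, (1 <= t <= T.+1)%N ->
       continuous (fun p : R * R => h t p.1 p.2))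
    (h_noninc : forall t, (1 <= t <= T.+1)%N -> forall x v w : R,
       v <= w -> h t x w <= h t x v)
    (g_pos : forall t, (t <= T.+2)%N -> 0 < g t)
    (alpha_lower : lower_solution T h g alpha)
    (beta_upper : upper_solution T h g beta)
    (alpha_le_beta : forall t, (1 <= t <= T.+1)%N -> alpha t <= beta t) :
  exists u : nat -> R,
    is_solution T h g u /\
    (forall t, (t <= T.+2)%N -> alpha t <= u t <= beta t).
Proof.
have [alpha_eq alpha0 alphaT] := alpha_lower.
have [beta_eq beta0 betaT] := beta_upper.
(* The boundary conditions get the signs that make [F i] nonnegative at [alpha] and nonpositive at
   [beta]; [F 0] is non-decreasing in [u 1], and the last equation involves [u T.+2] alone. *)
pose F i (u : nat -> R) :=
  if i is 0 then delta u 0%N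
  else if i == T.+2 then g T.+2 - u T.+2 else bvp_operator h u i.
have inner i : (i.+1 <= T.+2)%N -> (i.+1 == T.+2) = false -> (1 <= i.+1 <= T.+1)%N.
  by rewrite leq_eqVlt => /orP[->|].
have [||||| u Hu] := @perron_quasimonotone R nat (leq^~ T.+2) F alpha beta.
- move=> [|i] Di u v uv le_uv; rewrite /F.
    by rewrite /delta uv lerD2r le_uv.
  case: ifP => [/eqP E|/(inner i Di) Hi]; first by rewrite -E uv.
  apply: bvp_operator_quasimonotone _ _ _ (h_noninc _ Hi) uv _ _; apply: le_uv.
  + exact: ltnW.
  + by case/andP: Hi.
- move=> [|i] Di u; rewrite /F.
    rewrite /delta /= => x.
    by apply: cvgB; [exact: cvg_cst | exact: cvg_id].
  have [->|/negbTE /(inner i Di) Hi] := eqVneq i.+1 T.+2.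
    rewrite /= eqxx => x.
    by apply: cvgB; [exact: cvg_cst | exact: cvg_id].
  exact: bvp_operator_continuous _ _ _ (h_cont _ Hi).
(* The order at the endpoints comes from the boundary inequalities:
   [alpha 0 <= alpha 1 <= beta 1 <= beta 0], and [g T.+2] separates the values at [T.+2]. *)
- move=> [|i] Di.
    have := alpha_le_beta 1%N isT; move: alpha0 beta0; rewrite /delta; lra.
  have [->|/negbTE /(inner i Di)] := eqVneq i.+1 T.+2.
    exact: le_trans alphaT betaT.
  exact: alpha_le_beta.
- move=> [|i] Di; rewrite /F //.
  case: ifP => [_|/(inner i Di)]; [by rewrite subr_ge0 | exact: alpha_eq].
- move=> [|i] Di; rewrite /F //.
  case: ifP => [_|/(inner i Di)]; [by rewrite subr_le0 | exact: beta_eq].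
exists u; split=> [|t Dt]; last exact: (Hu t Dt).2.
split=> [[//|t] /andP[_ tT]||].
- have := (Hu t.+1 (leqW tT)).1.
  by rewrite /F ltn_eqF.
- exact: (Hu 0%N isT).1.
- have := (Hu T.+2 (leqnn _)).1.
  by rewrite /F eqxx => /eqP; rewrite subr_eq0 => /eqP.
Qed.
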